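(* Let $\Omega\in\mathcal B(\mathbb R^n)$ and let $C\subset\overline\Omega$ be a bounded density set of $\Omega$. Then for all $f\in L^\infty(\Omega)$ $$\inf_{\mu\in\mathrm{Dens}_C}\int_\Omega f\,d\mu=\lim_{\delta\downarrow0}\operatorname*{ess\,inf}_{C_\delta\cap\Omega}f\qquad\text{and}\qquad \sup_{\mu\in\mathrm{Dens}_C}\int_\Omega f\,d\mu=\lim_{\delta\downarrow0}\operatorname*{ess\,sup}_{C_\delta\cap\Omega}f .$$
   Context: $\mathcal L^n$ is Lebesgue measure on $\mathbb R^n$, $\mathcal B(\Omega)$ the Borel subsets of $\Omega$, $L^\infty(\Omega)=L^\infty(\Omega,\mathcal B(\Omega),\mathcal L^n)$; essential suprema and infima are with respect to $\mathcal L^n$. A measure on $\Omega$ means a finitely additive set function on $\mathcal B(\Omega)$ vanishing at $\emptyset$. $\mathrm{ba}(\Omega,\mathcal B(\Omega),\mathcal L^n)$ is the space of bounded real-valued finitely additive measures $\mu$ on $\mathcal B(\Omega)$ such that $\mu(A)=0$ whenever $\mathcal L^n(A)=0$; it is the dual of $L^\infty(\Omega)$ via $f\mapsto\int_\Omega f\,d\mu$ (for bounded $f$ the integral is obtained by uniform approximation with simple functions). $C_\delta$ denotes the open $\delta$-neighborhood of $C$ in $\mathbb R^n$. A set $C\subset\overline\Omega$ is a density set of $\Omega$ if $C$ is nonempty and closed in $\mathbb R^n$, $\mathcal L^n(C\cap\Omega)=0$, and $\mathcal L^n(C_\delta\cap\Omega)>0$ for all $\delta>0$. A measure $\mu\in\mathrm{ba}(\Omega,\mathcal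 B(\Omega),\mathcal L^n)$ is a density measure at $C$ (on $\Omega$) if $\mu\ge 0$ and $\mu(C_\delta\cap\Omega)=\mu(\Omega)=1$ for all $\delta>0$; $\mathrm{Dens}_C$ is the set of all of these. *)

(* Defs.v *)
From HB Require Import structures.
From mathcomp Require Import all_boot all_order all_algebra.
From mathcomp Require Import all_classical all_reals all_analysis.
From mathcomp Require Import measurable_realfun ess_sup_inf lra.

Set Implicit Arguments.
Unset Strict Implicit.
Unset Printing Implicit Defensive.

Import Order.TTheory GRing.Theory Num.Theory.
Import numFieldNormedType.Exports.
Import HBSimple.

Local Open Scope classical_set_scope.
Local Open Scope ring_scope.

Section borel_rV.
Variables (R : realType) (n : nat).

HB.instance Definition _ := @isMeasurable.Build
  (sigma_display (@open 'rV[R]_n)) 'rV[R]_n <<s @open 'rV[R]_n >>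
  (@sigma_algebra0 _ setT _) (@sigma_algebraC _ _)
  (@sigma_algebra_bigcup _ setT _).

Lemma open_measurable_rV (U : set 'rV[R]_n) : open U -> measurable U.
Proof. exact: sub_sigma_algebra. Qed.

Lemma measurable_coord_rV (i : 'I_n) :
  measurable_fun [set: 'rV[R]_n] (fun x => x ord0 i : measurableTypeR R).
Proof.
apply: (measurability _ (RGenOpens.measurableE R)) => _ [_ [a [b ->]] <-].
rewrite setTI; apply: open_measurable_rV.
apply: open_comp; last exact: interval_open.
by move=> x _; exact: coord_continuous.
Qed.

Lemma measurable_fun_rV d (T : measurableType d) (f : T -> 'rV[R]_n) :
  (forall i, measurable_fun [set: T] (fun t => f t ord0 i : measurableTypeR R)) ->
  measurable_fun [set: T] f.
Proof.
move=> mf; apply: (@measurability _ _ _ _ _ _ (@open 'rV[R]_n)) => //.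
move=> _ [U oU <-]; rewrite setTI.
pose B (p : 'rV[rat]_n * rat) : set 'rV[R]_n :=
  [set y | forall i, ratr (p.1 ord0 i) - ratr p.2 < y ord0 i /\
                     y ord0 i < ratr (p.1 ord0 i) + ratr p.2].
have -> : f @^-1` U =
    \bigcup_p (if `[< B p `<=` U >] then f @^-1` (B p) else set0).
  apply/seteqP; split => [t /= Uft|t [p _]]; last first.
    by case: ifPn => // /asboolP BU /BU.
  have : nbhs (f t) U by exact: open_nbhs_nbhs.
  rewrite -nbhs_ballE => -[e /= e0 eU].
  have [r /itvP re] : exists r : rat, ratr r \in `]0, e / 2[%R.
    by apply: rat_in_itvoo; rewrite divr_gt0.
  have r0 : 0 < ratr r :> R by rewrite re.
  have q_ i : exists q : rat, ratr q \in `](f t ord0 i - ratr r), (f t ord0 i + ratr r)[%R.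
    by apply: rat_in_itvoo; rewrite ltrBlDr -addrA ltrDl addr_gt0.
  have [q qP] := choice q_.
  exists (\row_i q i, r) => //.
  have -> : `[< B (\row_i q i, r) `<=` U >].
    apply/asboolP => y By; apply: eU; split => // i j.
    rewrite (ord1 i) /ball /= /ball_ /=.
    have /itvP qj := qP j; have [] := By j; rewrite /= mxE => b1 b2.
    have re2 : ratr r < e / 2 by rewrite re.
    have q1 : f t ord0 j - ratr r < ratr (q j) by rewrite qj.
    have q2 : ratr (q j) < f t ord0 j + ratr r by rewrite qj.
    by rewrite ltr_norml; apply/andP; split; lra.
  move=> i /=; rewrite mxE; have /itvP qi := qP i.
  have q1 : f t ord0 i - ratr r < ratr (q i) by rewrite qi.
  have q2 : ratr (q i) < f t ord0 i + ratr r by rewrite qi.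
  by split; lra.
apply: countable_bigcupT_measurable => // p.
case: ifPn => // _.
have -> : f @^-1` B p = \bigcap_(i in [set: 'I_n])
    ((fun t => f t ord0 i) @^-1`
      `](ratr (p.1 ord0 i) - ratr p.2), (ratr (p.1 ord0 i) + ratr p.2)[).
  apply/seteqP; split => t /=.
    by move=> h i _ /=; rewrite in_itv/=; have [-> ->] := h i.
  by move=> h i; have := h i I; rewrite /= in_itv/= => /andP[].
apply: fin_bigcap_measurable => // i _.
by rewrite -[X in measurable X]setTI; apply: mf => //; exact: measurable_itv.
Qed.

End borel_rV.

Section lebesgue_rV.
Variable R : realType.

Definition cons_rV n (p : measurableTypeR R * 'rV[R]_n) : 'rV[R]_n.+1 :=
  row_mx (p.1)%:M p.2.

Lemma cons_rV0 n p : @cons_rV n p ord0 ord0 = p.1.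
Proof.
have -> : ord0 = lshift n (ord0 : 'I_1) by exact: val_inj.
by rewrite [LHS]row_mxEl mxE eqxx mulr1n.
Qed.

Lemma cons_rVS n p (i : 'I_n) : @cons_rV n p ord0 (lift ord0 i) = p.2 ord0 i.
Proof.
have -> : lift ord0 i = rshift 1 i by exact: val_inj.
by rewrite [LHS]row_mxEr.
Qed.

Lemma measurable_cons_rV n : measurable_fun [set: _] (@cons_rV n).
Proof.
apply: measurable_fun_rV => i; case: (unliftP ord0 i) => [j ->|->].
  under eq_fun do rewrite cons_rVS.
  exact: measurableT_comp (measurable_coord_rV j) measurable_snd.
by under eq_fun do rewrite cons_rV0; exact: measurable_fst.
Qed.

Definition uncons_rV n (x : 'rV[R]_n.+1) : measurableTypeR R * 'rV[R]_n :=
  (x ord0 ord0, \row_i x ord0 (lift ord0 i)).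

Lemma measurable_uncons_rV n : measurable_fun [set: _] (@uncons_rV n).
Proof.
apply/measurable_fun_pairP; split; first exact: measurable_coord_rV.
apply: measurable_fun_rV => i /=.
by under eq_fun do rewrite mxE; exact: measurable_coord_rV.
Qed.

Lemma cons_rVK n : cancel (@cons_rV n) (@uncons_rV n).
Proof.
move=> [a x]; congr pair; first by rewrite cons_rV0.
by apply/rowP => i; rewrite mxE cons_rVS.
Qed.

Section step.
Variables (n : nat) (m : {sigma_finite_measure set 'rV[R]_n -> \bar R}).

Definition lebesgue_step : set 'rV[R]_n.+1 -> \bar R :=
  pushforward (lebesgue_measure \x m)%E (@cons_rV n).

Let mcons (A : set 'rV[R]_n.+1) : measurable A -> measurable (@cons_rV n @^-1` A).
Proof.
by move=> mA; rewrite -[X in measurable X]setTI; exact: measurable_cons_rV.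
Qed.

Let step0 : lebesgue_step set0 = 0%E.
Proof. by rewrite /lebesgue_step /pushforward preimage_set0 measure0. Qed.

Let step_ge0 A : (0 <= lebesgue_step A)%E.
Proof. exact: (@measure_ge0 _ _ _ (lebesgue_measure \x m)%E). Qed.

Let step_sigma_additive : semi_sigma_additive lebesgue_step.
Proof.
move=> F mF tF mUF; rewrite /lebesgue_step /pushforward preimage_bigcup.
apply: (@measure_semi_sigma_additive _ _ _ (lebesgue_measure \x m)%E).
- by move=> k; exact: mcons.
- apply/trivIsetP => /= i j _ _ ij; rewrite -preimage_setI.
  by move/trivIsetP : tF => /(_ _ _ _ _ ij) ->//; rewrite preimage_set0.
- by rewrite -preimage_bigcup; exact: mcons.
Qed.

HB.instance Definition _ := isMeasure.Build _ _ _ lebesgue_step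
  step0 step_ge0 step_sigma_additive.

Let step_sigma_finite : sigma_finite setT lebesgue_step.
Proof.
have /sigma_finiteP[F [TF ndF Foo]] :=
  sigma_finiteT (@lebesgue_measure R : {sigma_finite_measure set _ -> \bar R}).
have /sigma_finiteP[G [TG ndG Goo]] := sigma_finiteT m.
exists (fun k => @uncons_rV n @^-1` (F k `*` G k)).
  rewrite -preimage_bigcup -[LHS](preimage_setT (@uncons_rV n)).
  congr (_ @^-1` _); rewrite -setXTT TF TG predeqE => -[x y]; split.
    move=> [/= [i _ Fix] [k _ Gky]]; exists (maxn i k) => //; split.
    - by move: x Fix; exact/subsetPset/ndF/leq_maxl.
    - by move: y Gky; exact/subsetPset/ndG/leq_maxr.
  by move=> [i _ []/= ? ?]; split; exists i.
move=> k; have [mF Fk] := Foo k; have [mG Gk] := Goo k; split.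
  rewrite -[X in measurable X]setTI; apply: measurable_uncons_rV => //.
  exact: measurableX.
rewrite /lebesgue_step /pushforward.
rewrite [X in (lebesgue_measure \x m)%E X](_ : _ = F k `*` G k).
  by rewrite product_measure1E// lte_mul_pinfty// ge0_fin_numE.
by rewrite predeqE => p; rewrite -{2}(cons_rVK p).
Qed.

HB.instance Definition _ := Measure_isSigmaFinite.Build _ _ _ lebesgue_step
  step_sigma_finite.

End step.

Fixpoint lebesgue_rV n : {sigma_finite_measure set 'rV[R]_n -> \bar R} :=
  match n with
  | 0 => \d_(0 : 'rV[R]_0)
  | n'.+1 => lebesgue_step (lebesgue_rV n')
  end.

Definition box_rV n (a b : 'rV[R]_n) : set 'rV[R]_n :=
  [set x | forall i, a ord0 i <= x ord0 i <= b ord0 i].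

Lemma measurable_box_rV n (a b : 'rV[R]_n) :
  measurable (box_rV a b).
Proof.
have -> : box_rV a b =
    \bigcap_(i in [set: 'I_n])
      ((fun x : 'rV[R]_n => x ord0 i) @^-1` `[a ord0 i, b ord0 i]).
  apply/seteqP; split => x /= h i.
    by move=> _; rewrite /= in_itv/=; exact: h.
  by have := h i I; rewrite /= in_itv.
apply: fin_bigcap_measurable => // i _.
rewrite -[X in measurable X]setTI.
by apply: measurable_coord_rV => //; exact: measurable_itv.
Qed.

(* The normalization that characterizes Lebesgue measure. *)
Lemma lebesgue_rV_box n (a b : 'rV[R]_n) : (forall i, a ord0 i <= b ord0 i) ->
  lebesgue_rV n (box_rV a b) =
  (\prod_i (b ord0 i - a ord0 i))%:E.
Proof.
elim: n a b => [|n ih] a b ab.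
  by rewrite big_ord0 /= diracE mem_set// => -[].
pose a' : 'rV[R]_n := (uncons_rV a).2; pose b' : 'rV[R]_n := (uncons_rV b).2.
rewrite [LHS](_ : _ = (lebesgue_measure \x lebesgue_rV n)%E
  (`[a ord0 ord0, b ord0 ord0]%classic `*`
   box_rV a' b')); last first.
  congr (_ : \bar R); rewrite /= /lebesgue_step /pushforward.
  congr (product_measure1 _ _ _); apply/seteqP; split => -[t x] /=.
    move=> h; split; first by have := h ord0; rewrite cons_rV0 in_itv.
    by move=> i; have := h (lift ord0 i); rewrite cons_rVS !mxE.
  move=> [h0 h] i; case: (unliftP ord0 i) => [j ->|->].
    by have := h j; rewrite cons_rVS !mxE.
  by rewrite cons_rV0; rewrite in_itv in h0.
rewrite product_measure1E//; last exact: measurable_box_rV.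
rewrite ih => [|i]; last by rewrite !mxE.
rewrite big_ord_recl EFinM; congr (_ * _)%E.
  rewrite [LHS]lebesgue_measure_itv/= lte_fin.
  by case: ltgtP (ab ord0) => // ->; rewrite subrr.
by congr EFin; apply: eq_bigr => i _; rewrite !mxE.
Qed.

End lebesgue_rV.
Arguments lebesgue_rV {R n}.

Section density.
Variables (R : realType) (n : nat).
Local Notation E := 'rV[R]_n.
Implicit Types (Omega C : set E) (f : E -> R).

(* The canonical norm of 'rV[R]_n is the sup norm, whence this definition. *)
Definition eucl_dist (x y : E) : R :=
  Num.sqrt (\sum_i (x ord0 i - y ord0 i) ^+ 2).

Definition thickening C (delta : R) : set E :=
  [set x | exists2 y, C y & eucl_dist x y < delta].

Lemma open_thickening C delta : open (thickening C delta).
Proof.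
have -> : thickening C delta =
    \bigcup_(y in C) (eucl_dist^~ y @^-1` [set r | r < delta]).
  by apply/seteqP; split => x [y Cy xy]; exists y.
apply: bigcup_open => y _; apply: open_comp; last exact: open_lt.
have cS : continuous (fun x : E => \sum_i (x ord0 i - y ord0 i) ^+ 2).
  apply: continuous_big => [|i _ x]; first exact: add_continuous.
  apply: (@continuous_comp _ _ _ (fun z : E => z ord0 i - y ord0 i)
    (fun r : R => r ^+ 2)).
    apply: (@continuousB _ _ _ (fun z : E => z ord0 i) (fun=> y ord0 i)).
      exact: coord_continuous.
    exact: cst_continuous.
  exact: exprn_continuous.
by move=> x _; apply: continuous_comp (cS x) _; exact: sqrt_continuous.
Qed.

Lemma measurable_thickeningI Omega C delta :
  measurable Omega -> measurable (thickening C delta `&` Omega).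
Proof.
move=> mOmega; apply: measurableI => //.
by apply: open_measurable_rV; exact: open_thickening.
Qed.

Definition density_set Omega C : Prop :=
  [/\ C `<=` closure Omega, C !=set0, closed C,
      lebesgue_rV (C `&` Omega) = 0%E &
      forall delta, 0 < delta ->
        (0 < lebesgue_rV (thickening C delta `&` Omega))%E].

(* Elements of L^oo(Omega) are represented by functions on the whole space,
   whose values outside Omega are irrelevant. *)
Definition Linfty Omega (mOmega : measurable Omega) : set (E -> R) :=
  [set f | measurable_fun Omega f /\
           finite_norm (mrestr lebesgue_rV mOmega) +oo%E f].

(* A measure on Omega is represented by a set function of which only the values
   on Borel subsets of Omega are constrained and used. *)
Definition borel_subset Omega : set (set E) :=
  [set A | measurable A /\ A `<=` Omega].

Record ba Omega (mu : set E -> R) : Prop := {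
  ba_set0 : mu set0 = 0 ;
  ba_additive : forall A B, borel_subset Omega A -> borel_subset Omega B ->
    A `&` B = set0 -> mu (A `|` B) = mu A + mu B ;
  ba_bounded : exists M : R, forall A, borel_subset Omega A -> `|mu A| <= M ;
  ba_null : forall A, borel_subset Omega A -> lebesgue_rV A = 0%E -> mu A = 0 }.

Definition density_measure Omega C (mu : set E -> R) : Prop :=
  [/\ ba Omega mu,
      (forall A, borel_subset Omega A -> 0 <= mu A),
      (forall delta, 0 < delta -> mu (thickening C delta `&` Omega) = 1) &
      mu Omega = 1].

(* Neighborhoods of the class of f in L^oo(Omega), traced on Borel simple
   functions. *)
Definition simple_approx Omega f : set_system {sfun E >-> R} :=
  filter_from [set e : R | 0 < e] (fun e =>
    [set s : {sfun E >-> R} |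
      \forall x \ae lebesgue_rV, Omega x -> `|f x - s x| < e]).

Definition ba_integral Omega (mu : set E -> R) f : \bar R :=
  lim ((fun s : {sfun E >-> R} =>
    sintegral (fun A => (mu (A `&` Omega))%:E) s) @ simple_approx Omega f).

End density.

(* Main.v *)
Require Import Defs.
From HB Require Import structures.
From mathcomp Require Import all_boot all_order all_algebra finmap.
From mathcomp Require Import all_classical all_reals all_analysis.
From mathcomp Require Import measurable_realfun ess_sup_inf.
From mathcomp Require Import lra.

Set Implicit Arguments.
Unset Strict Implicit.
Unset Printing Implicit Defensive.

Import Order.TTheory GRing.Theory Num.Theory.
Import numFieldNormedType.Exports.
Import HBSimple.

Local Open Scope classical_set_scope.
Local Open Scope ring_scope.

(** The measures that matter are the zero-one measures of ultrafilters.  Call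
    c an essential cluster value of f at C when, for every r > 0, the set of
    the x in C_r and Omega with |f x - c| < r is not Lebesgue-null.  These
    sets, taken modulo null sets, then generate a proper filter; the zero-one
    measure of an ultrafilter U refining it vanishes on null sets and gives
    mass 1 to each C_r, so it is a density measure at C, and the integral of f
    against it is the limit of f along U, which is c
    ([ess_cluster_value_integral]).

    Conversely, a density measure is carried by C_r for every r, so the
    integral of f lies between the essential bounds of f on C_r
    ([ba_integral_bounds]).  As delta decreases to 0 the essential infimum
    over C_delta increases, hence converges to its supremum l; this l is itself
    an essential cluster value of f at C, because f is almost
    everywhere above l - e close to C, but on no C_r is it almost everywhere
    above l + e ([ess_inf_cvg_cluster]).  So l is a
    lower bound of the integrals and it is attained: the infimum is a minimum.
    The supremum is treated by applying the same limit statement to - f.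

    The integral against a finitely additive measure is defined as a limit of
    simple integrals, so a comparison principle for the latter has to come
    first ([le_simple_integral]); it yields the Cauchy property and the bounds
    of the limit at once.  That this limit is taken along a proper filter is
    the uniform approximation of bounded functions by simple functions
    ([sfun_approximation]). *)

(** * Simple integrals against a finitely additive measure *)

Section finitely_additive.
Context d (T : measurableType d) (R : realType) (nu : set T -> R).
Hypothesis nu0 : nu set0 = 0.
Hypothesis nuU : forall A B, measurable A -> measurable B ->
  A `&` B = set0 -> nu (A `|` B) = nu A + nu B.
Hypothesis nu_ge0 : forall A, measurable A -> 0 <= nu A.

Lemma additive_le A B : measurable A -> measurable B -> A `<=` B ->
  nu A <= nu B.
Proof.
move=> mA mB AB; rewrite -(setDUK AB) nuU ?setDIK//; last exact: measurableD.
by rewrite lerDl nu_ge0//; exact: measurableD.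
Qed.

Lemma additive_sum (t : {sfun T >-> R}) (A : set T) (s : seq R) :
  measurable A -> uniq s ->
  nu (A `&` t @^-1` [set` s]) = \sum_(y <- s) nu (A `&` t @^-1` [set y]).
Proof.
move=> mA; elim: s => [_|y s ih /= /andP[ys us]].
  by rewrite big_nil set_nil preimage_set0 setI0.
have ms : measurable ([set` s] : set R).
  apply: countable_measurable.
    by move=> x; exact: measurable_set1.
  exact/finite_set_countable/finite_seq.
have -> : [set` y :: s] = [set y] `|` [set` s].
  by apply/seteqP; split => z; rewrite /= inE; [case/predU1P; [left|right]|
     case=> [/eqP ->|->]; rewrite ?orbT].
rewrite big_cons -ih// preimage_setU setIUr nuU//.
  by apply: measurableI => //; apply: measurable_funPTI.
by rewrite -subset0 => x [[_ /= ->]] [_ /=]; rewrite (negbTE ys).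
Qed.

Definition simple_integral (s : {sfun T >-> R}) : R :=
  \sum_(x <- fset_set (range s)) x * nu (s @^-1` [set x]).

Lemma sintegral_EFin (s : {sfun T >-> R}) :
  sintegral (fun A => (nu A)%:E) s = (simple_integral s)%:E.
Proof.
rewrite /sintegral -(fsbig_widen (range s) setT)//=; last first.
  by move=> x [_ sx] /=; rewrite [X in nu X](_ : _ = set0) ?nu0 ?mule0//;
     exact: preimage10.
by rewrite fsbig_finite//= sumEFin.
Qed.

Lemma additive_range (t : {sfun T >-> R}) (A : set T) : measurable A ->
  \sum_(y <- fset_set (range t)) nu (A `&` t @^-1` [set y]) = nu A.
Proof.
move=> mA; rewrite -additive_sum ?fset_uniq//; congr (nu _).
apply/seteqP; split => [x []//|x Ax]; split => //.
change (t x \in fset_set (range t)).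
by rewrite in_fset_set// inE; exists x.
Qed.

Lemma additive_rangeT (t : {sfun T >-> R}) :
  \sum_(y <- fset_set (range t)) nu (t @^-1` [set y]) = nu setT.
Proof.
rewrite -(additive_range t measurableT).
by apply: eq_bigr => y _; rewrite setTI.
Qed.

Lemma simple_integral_refine (s t : {sfun T >-> R}) :
  simple_integral s = \sum_(x <- fset_set (range s))
    \sum_(y <- fset_set (range t)) x * nu (s @^-1` [set x] `&` t @^-1` [set y]).
Proof. by apply: eq_bigr => x _; rewrite -mulr_sumr additive_range. Qed.

(** Comparison principle.  Both integrals are written as double sums over the
    common refinement of the level sets of [s] and [t] and compared term by
    term: a cell either lies in [N], hence has measure zero, or contains a point
    where the values x of [s] and y of [t] satisfy x <= y + e. *)
Lemma le_simple_integral (s t : {sfun T >-> R}) (N : set T) (e : R) :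
  measurable N -> nu N = 0 -> (forall x, ~ N x -> s x <= t x + e) ->
  simple_integral s <= simple_integral t + e * nu setT.
Proof.
move=> mN N0 st; rewrite (simple_integral_refine s t).
rewrite (simple_integral_refine t s) exchange_big/= -(additive_rangeT t).
rewrite mulr_sumr -big_split/=; apply: ler_sum => y _.
rewrite -(@additive_range s (t @^-1` [set y]))// mulr_sumr -big_split/=.
apply: ler_sum => x _; rewrite [t @^-1` [set y] `&` _]setIC -mulrDl.
set A := _ `&` _; have mA : measurable A by exact: measurableI.
have [AN|] := pselect (A `<=` N).
  suff -> : nu A = 0 by rewrite !mulr0.
  by apply/eqP; rewrite eq_le nu_ge0// -N0 additive_le.
move=> /existsNP[z /not_implyP[[/= <- <-] Nz]].
by rewrite ler_wpM2r ?nu_ge0// st.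
Qed.

Lemma simple_integral_cst (c : R) :
  simple_integral (cst_sfun c) = c * nu setT.
Proof.
rewrite -(additive_rangeT (cst_sfun c)) mulr_sumr.
rewrite /simple_integral !big_seq; apply: eq_bigr => x.
by rewrite in_fset_set// inE => -[y _ <-].
Qed.

End finitely_additive.

(** * Uniform approximation by simple functions *)

Section step_approximation.
Variable R : realType.

(** The sum rounds [y] down to the grid of mesh [e], one step [e] for each of the
    first [N] positive multiples of [e] that [y] has passed.  In this form it is
    a sum of indicators when [y] varies.  The first conjunct serves the
    induction. *)
Lemma sum_steps (e y : R) (N : nat) : 0 < e -> 0 <= y ->
  let c := \sum_(k < N) e * (k.+1%:R * e <= y)%R%:R in
  (N%:R * e <= y -> c = N%:R * e) /\ (y < N%:R * e -> c <= y < c + e).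
Proof.
move=> e0 y0 /=; elim: N => [|N [ihle ihlt]].
  by rewrite big_ord0 mul0r; split=> //; rewrite ltNge y0.
rewrite big_ord_recr/=; set c := \sum_(k < N) _ in ihle ihlt *.
have NS : N.+1%:R * e = N%:R * e + e by rewrite -natr1 mulrDl mul1r.
split=> [Ny|yN].
  have Ny' : N%:R * e <= y by apply: le_trans Ny; rewrite NS lerDl ltW.
  by rewrite Ny mulr1 ihle// NS.
rewrite [_ * e <= y]leNgt yN/= mulr0 addr0.
have [Ny|] := leP (N%:R * e) y; last exact: ihlt.
by rewrite ihle// Ny/= -NS.
Qed.

(** The values of [f] in [-M, M] are rounded down to a grid of mesh [e] starting
    at [- M]. *)
Lemma sfun_approximation d (T : measurableType d) (D : set T) (f : T -> R)
    (M e : R) : measurable D -> measurable_fun D f -> 0 < e ->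
  exists s : {sfun T >-> R},
    forall x, D x -> `|f x| <= M -> `|f x - s x| < e.
Proof.
move=> mD mf e0.
have mA (k : nat) : measurable (D `&` f @^-1` `[k.+1%:R * e - M, +oo[).
  exact: mf (measurable_itv _).
pose N := (Num.truncn (2 * M / e)).+1.
exists (cst_sfun (- M) +
  \sum_(k < N) scale_sfun e (indic_sfun _ (mA k))) => x Dx fM.
rewrite sfunD /= sfun_sum.
have y0 : 0 <= f x + M by have := lerNnormlW fM; rewrite -subr_ge0 opprK.
have yN : f x + M < N%:R * e.
  rewrite -ltr_pdivrMr// (le_lt_trans _ (truncnS_gt _))//.
  have fxM : f x <= M := le_trans (ler_norm _) fM.
  by rewrite ler_pM2r ?invr_gt0//; lra.
have [_ /(_ yN)] := sum_steps N e0 y0.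
have -> : \sum_(k < N) e * (k.+1%:R * e <= f x + M)%R%:R =
    \sum_(k < N) scale_sfun e (indic_sfun _ (mA k)) x.
  apply: eq_bigr => k _; rewrite /= /mindic indicE mulrC; congr (_%:R * _).
  congr nat_of_bool; rewrite -lerBlDr; apply/idP/idP => [h|].
    by rewrite inE; split => //=; rewrite in_itv/= h.
  by rewrite inE => -[_ /=]; rewrite in_itv/= andbT.
by move=> /andP[h1 h2]; rewrite ltr_norml; apply/andP; split; lra.
Qed.

End step_approximation.

(** * Integrals of essentially bounded functions *)

Section integral_bounds.
Variables (R : realType) (n : nat).
Local Notation E := 'rV[R]_n.
Implicit Types (Omega D : set E) (f : E -> R).

Lemma simple_approx_proper Omega f (M : R) : measurable Omega ->
  measurable_fun Omega f ->
  (\forall x \ae lebesgue_rV, Omega x -> `|f x| <= M) ->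
  ProperFilter (simple_approx Omega f).
Proof.
move=> mOmega mf fM; apply: filter_from_proper.
  apply: filter_from_filter; first by exists 1; rewrite /= ltr01.
  move=> i j /= i0 j0; exists (Num.min i j); first by rewrite /= lt_min i0.
  move=> s /= h; split; apply: filterS h => x h /h;
    by rewrite lt_min => /andP[].
move=> e /= e0; have [s sP] := sfun_approximation M mOmega mf e0.
by exists s; apply: filterS fM => x h Ox; apply: sP => //; exact: h.
Qed.

Variables (Omega : set E) (mu : set E -> R).
Hypotheses (mOmega : measurable Omega) (bamu : ba Omega mu)
  (mu_ge0 : forall A, borel_subset Omega A -> 0 <= mu A)
  (mu1 : mu Omega = 1).

(** Simple functions live on the whole space: [nu] is [mu] extended by zero
    outside [Omega]. *)
Let nu (A : set E) := mu (A `&` Omega).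

Let borel_subsetIr A : measurable A -> borel_subset Omega (A `&` Omega).
Proof. by move=> mA; split; [exact: measurableI|exact: subIsetr]. Qed.

Let nu0 : nu set0 = 0.
Proof. by rewrite /nu set0I (ba_set0 bamu). Qed.

Let nuU A B : measurable A -> measurable B ->
  A `&` B = set0 -> nu (A `|` B) = nu A + nu B.
Proof.
move=> mA mB AB; rewrite /nu setIUl (ba_additive bamu)//;
  [exact: borel_subsetIr|exact: borel_subsetIr|].
by rewrite setIACA AB set0I.
Qed.

Let nu_ge0 A : measurable A -> 0 <= nu A.
Proof. by move=> mA; apply: mu_ge0; exact: borel_subsetIr. Qed.

Let nuT : nu setT = 1.
Proof. by rewrite /nu setTI. Qed.

Let nu_null D (N : set E) : borel_subset Omega D -> mu D = 1 ->
  measurable N -> lebesgue_rV N = 0%E -> nu (~` D `|` N) = 0.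
Proof.
move=> bD D1 mN N0; have [mD DO] := bD.
have nuD : nu D = 1 by rewrite /nu setIidl.
have mCD : measurable (~` D) by exact: measurableC.
have nuCD : nu (~` D) = 0.
  have : nu (D `|` ~` D) = nu D + nu (~` D) by apply: nuU; rewrite ?setICr.
  by rewrite setUv nuT nuD -{1}(addr0 1) => /addrI.
have nuN0 : nu N = 0.
  apply: (ba_null bamu); first exact: borel_subsetIr.
  apply: (subset_measure0 _ mN) N0; first exact: measurableI.
  exact: subIsetl.
have -> : ~` D `|` N = ~` D `|` N `&` D.
  by rewrite setUIr (setUC _ D) setUv setIT.
rewrite nuU ?nuCD ?add0r//;
  [|exact: measurableI|by rewrite setIC -setIA setICr setI0].
apply/eqP; rewrite eq_le nu_ge0 ?andbT; last exact: measurableI.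
by rewrite -nuN0; apply: (additive_le nuU nu_ge0) => //; exact: measurableI.
Qed.

Local Notation I := (simple_integral nu).

(** Lebesgue-null sets and the complement of a set of full [mu]-measure are
    both negligible for [mu], so a comparison of simple functions that holds
    almost everywhere on such a set suffices. *)
Lemma ba_le_simple D (s t : {sfun E >-> R}) (e : R) : borel_subset Omega D ->
  mu D = 1 -> (\forall x \ae lebesgue_rV, D x -> s x <= t x + e) ->
  I s <= I t + e.
Proof.
move=> bD D1 [N [mN N0 hN]].
have mCDN : measurable (~` D `|` N).
  by apply: measurableU => //; apply: measurableC; case: bD.
have := @le_simple_integral _ _ _ _ nu0 nuU nu_ge0 s t _ e mCDN
  (nu_null bD D1 mN N0).
rewrite nuT mulr1; apply => x /not_orP[/contrapT Dx Nx].
by apply: contrapT => h; apply: Nx; apply: hN => /(_ Dx).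
Qed.

Variables (f : E -> R) (M : R).
Hypotheses (mf : measurable_fun Omega f)
  (fM : \forall x \ae lebesgue_rV, Omega x -> `|f x| <= M).

(** Comparing two simple approximations of [f] with each other gives the Cauchy
    property, so the integral exists as a real number; comparing one with
    constants gives the bounds.  That only the values of [f] on a set [D] of
    full measure count is what localizes the integral near [C]. *)
Lemma ba_integral_bounds : exists l : R, ba_integral Omega mu f = l%:E /\
  forall D a b, borel_subset Omega D -> mu D = 1 ->
    (\forall x \ae lebesgue_rV, D x -> a <= f x <= b) -> a <= l <= b.
Proof.
have FF := simple_approx_proper mOmega mf fM.
have bO : borel_subset Omega Omega by split.
have : cvg (I @ simple_approx Omega f).
  apply/cauchy_cvgP/cauchy_exP => e e0; have e4 : 0 < e / 4 by rewrite divr_gt0.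
  pose A := [set s : {sfun E >-> R} |
    \forall x \ae lebesgue_rV, Omega x -> `|f x - s x| < e / 4].
  have FA : simple_approx Omega f A by exists (e / 4).
  have [s0 As0] := filter_ex FA.
  exists (I s0); apply: filterS FA => s As.
  have h1 : I s <= I s0 + e / 2.
    apply: (ba_le_simple bO mu1); apply: filterS2 As As0 => x h1 h2 Ox.
    by move: (h1 Ox) (h2 Ox); rewrite !ltr_norml => /andP[? ?] /andP[? ?]; lra.
  have h2 : I s0 <= I s + e / 2.
    apply: (ba_le_simple bO mu1); apply: filterS2 As As0 => x {}h1 h2 Ox.
    by move: (h1 Ox) (h2 Ox); rewrite !ltr_norml => /andP[? ?] /andP[? ?]; lra.
  by rewrite /ball /= /ball_ ltr_norml; apply/andP; split; lra.
move=> /cvg_ex[l Il]; exists l; split.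
  apply/cvg_lim; first exact: ereal_hausdorff.
  rewrite (_ : (fun s : {sfun E >-> R} => _) = EFin \o I); last first.
    by apply/funext => s; exact: (sintegral_EFin nu0).
  by apply: cvg_EFin; [exact: nearW|exact: Il].
move=> D a b bD D1 ab.
have near_ab e : 0 < e -> \forall s \near simple_approx Omega f,
    a - e <= I s <= b + e.
  move=> e0; exists e => // s hs; have DO := bD.2.
  apply/andP; split.
    rewrite lerBlDr -[a]mulr1 -nuT -(simple_integral_cst nu0 nuU).
    apply: (ba_le_simple bD D1); apply: filterS2 hs ab => x h /[swap] Dx /(_ Dx).
    by move: (h (DO _ Dx)); rewrite ltr_norml/= => /andP[? ?] /andP[? ?]; lra.
  rewrite -[b]mulr1 -nuT -(simple_integral_cst nu0 nuU).
  apply: (ba_le_simple bD D1); apply: filterS2 hs ab => x h /[swap] Dx /(_ Dx).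
  by move: (h (DO _ Dx)); rewrite ltr_norml/= => /andP[? ?] /andP[? ?]; lra.
apply/andP; split; apply/ler_addgt0Pr => e e0.
  rewrite -lerBlDr; apply: (cvgr_to_ge Il).
  by apply: filterS (near_ab _ e0) => s /andP[].
by apply: (cvgr_to_le Il); apply: filterS (near_ab _ e0) => s /andP[].
Qed.

End integral_bounds.

(** * Zero-one density measures *)

Section ultrafilter_density.
Variables (R : realType) (n : nat).
Local Notation E := 'rV[R]_n.
Variables (Omega C : set E).
Hypothesis mOmega : measurable Omega.

(** A single radius controls both the distance to [C] and the distance of the
    values to [c], so that these sets form a chain. *)
Definition near_value (f : E -> R) (c r : R) : set E :=
  (thickening C r `&` Omega) `&` [set x | `|f x - c| < r].

Definition ess_cluster_value (f : E -> R) (c : R) : Prop :=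
  forall r, 0 < r -> ~ \forall x \ae lebesgue_rV, ~ near_value f c r x.

Lemma thickeningS (r r' : R) : r <= r' -> thickening C r `<=` thickening C r'.
Proof. by move=> rr' x [y Cy xy]; exists y => //; exact: lt_le_trans rr'. Qed.

Lemma near_valueS f c r r' : r <= r' -> near_value f c r `<=` near_value f c r'.
Proof.
move=> rr' x [[Cx Ox] /= fx]; split; last exact: lt_le_trans rr'.
by split => //; exact: thickeningS rr' _ Cx.
Qed.

Lemma measurable_near_value f c r : measurable_fun Omega f ->
  measurable (near_value f c r).
Proof.
move=> mf; rewrite /near_value -setIA; apply: measurableI.
  by apply: open_measurable_rV; exact: open_thickening.
rewrite (_ : [set x | _] = f @^-1` `](c - r), (c + r)[).
  exact: mf (measurable_itv _).
by apply/seteqP; split => x /=; rewrite in_itv/= ltr_distl.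
Qed.

Section zero_one_measure.
Variable U : set_system E.
Hypothesis UU : UltraFilter U.

Definition ultrafilter_measure (A : set E) : R := `[< U A >]%:R.

Lemma ultrafilter_measure1 A : U A -> ultrafilter_measure A = 1.
Proof. by move=> UA; rewrite /ultrafilter_measure asboolT. Qed.

Lemma ultrafilter_measure0 A : U (~` A) -> ultrafilter_measure A = 0.
Proof.
move=> UA; rewrite /ultrafilter_measure asboolF// => UA'.
by have [x []] := filter_ex (filterI UA UA').
Qed.

Lemma ultrafilter_measureU A B : A `&` B = set0 ->
  ultrafilter_measure (A `|` B) =
  ultrafilter_measure A + ultrafilter_measure B.
Proof.
move=> AB0; have [UA|UA] := in_ultra_setVsetC A UU.
  rewrite !(@ultrafilter_measure1 A)// ultrafilter_measure1.
    rewrite ultrafilter_measure0 ?addr0//; apply: filterS UA.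
    exact/disjoints_subset.
  by apply: filterS UA; exact: subsetUl.
rewrite (ultrafilter_measure0 UA) add0r.
have [UB|UB] := in_ultra_setVsetC B UU.
  by rewrite !ultrafilter_measure1//; apply: filterS UB; exact: subsetUr.
by rewrite !ultrafilter_measure0// setCU; exact: filterI.
Qed.

Lemma ba_ultrafilter_measure :
  (forall A, measurable A -> lebesgue_rV A = 0%E -> U (~` A)) ->
  ba Omega ultrafilter_measure.
Proof.
move=> Unull; split.
- by rewrite ultrafilter_measure0// setC0; exact: filterT.
- by move=> A B _ _; exact: ultrafilter_measureU.
- exists 1 => A _; rewrite /ultrafilter_measure.
  by case: asboolP => _; rewrite ?normr1// normr0.
- by move=> A [mA _] A0; exact/ultrafilter_measure0/Unull.
Qed.

End zero_one_measure.

(** Every essential cluster value is the integral of [f] against some density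
    measure.  The filter generated by the sets [near_value f c r] and the
    complements of null sets is proper exactly because [c] is a cluster value;
    any ultrafilter above it contains all these sets, so that its zero-one
    measure is carried by them and sees only values of [f] close to [c]. *)
Lemma ess_cluster_value_integral (f : E -> R) (M c : R) :
  measurable_fun Omega f ->
  (\forall x \ae lebesgue_rV, Omega x -> `|f x| <= M) ->
  ess_cluster_value f c ->
  exists2 mu, density_measure Omega C mu & ba_integral Omega mu f = c%:E.
Proof.
move=> mf fM fc.
pose F : set_system E := [set A | exists2 r, 0 < r &
  \forall x \ae lebesgue_rV, near_value f c r x -> A x].
have FF : ProperFilter F.
  split.
    move=> [r r0 h]; apply: (fc r r0); exact: h.
  split.
  - by exists 1 => //; exact: aeW.
  - move=> A B [r r0 hA] [r' r'0 hB]; exists (Num.min r r').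
      by rewrite lt_min r0.
    apply: filterS2 hA hB => x hA hB h; split.
      by apply: hA; apply: near_valueS h; rewrite ge_min lexx.
    by apply: hB; apply: near_valueS h; rewrite ge_min lexx orbT.
  - by move=> A B AB [r r0 hA]; exists r => //; apply: filterS hA => x hA /hA/AB.
have [U [UU FU]] := ultraFilterLemma FF.
have U_near r : 0 < r -> U (near_value f c r).
  by move=> r0; apply: FU; exists r => //; exact: aeW.
pose mu := ultrafilter_measure U.
have bamu : ba Omega mu.
  apply: ba_ultrafilter_measure => // A mA A0; apply: FU; exists 1 => //.
  by exists A; split => // x /=; rewrite not_implyE => -[_ /contrapT].
have mu_ge0 A : borel_subset Omega A -> 0 <= mu A by move=> _; exact: ler0n.
have muO : mu Omega = 1.
  apply: ultrafilter_measure1; apply: filterS (U_near 1 ltr01).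
  by move=> x [[]].
exists mu.
  split => // r r0; apply: ultrafilter_measure1; apply: filterS (U_near r r0).
  by move=> x [].
have [l [-> hl]] := ba_integral_bounds mOmega bamu mu_ge0 muO mf fM.
congr EFin.
have lc r : 0 < r -> c - r <= l <= c + r.
  move=> r0; apply: (hl (near_value f c r)).
  - by split; [exact: measurable_near_value|move=> x [[]]].
  - exact/ultrafilter_measure1/U_near.
  - by apply: aeW => x [_ /=]; rewrite ltr_distl => /andP[? ?]; rewrite !ltW.
apply/eqP; rewrite eq_le; apply/andP; split; apply/ler_addgt0Pr => e /lc/andP[]//.
by rewrite lerBlDr.
Qed.

End ultrafilter_density.

(** * Limits of essential infima *)

Section essential_limits.

Lemma ae_mrestr d (T : measurableType d) (R : realType)
    (m : {measure set T -> \bar R}) (D : set T) (mD : measurable D)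
    (P : T -> Prop) :
  (\forall x \ae mrestr m mD, P x) <-> (\forall x \ae m, D x -> P x).
Proof.
split=> -[N [mN N0 hN]].
  exists (N `&` D); split => //; first exact: measurableI.
  by move=> x /not_implyP[Dx Px]; split => //; exact: hN.
exists (N `|` ~` D); split.
- by apply: measurableU => //; exact: measurableC.
- rewrite /mrestr setIUl setICl setU0; apply: (subset_measure0 _ mN) N0.
    exact: measurableI.
  exact: subIsetl.
- move=> x /= Px; have [Dx|] := pselect (D x); last by right.
  by left; apply: hN => /(_ Dx).
Qed.

Variables (R : realType) (n : nat).
Local Notation E := 'rV[R]_n.
Variables (Omega C : set E).
Hypothesis mOmega : measurable Omega.

Lemma Linfty_ae_bounded (f : E -> R) : (0 < lebesgue_rV Omega)%E ->
  Linfty mOmega f ->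
  exists M : R, \forall x \ae lebesgue_rV, Omega x -> `|f x| <= M.
Proof.
move=> O0 [_].
have O0' : (0 < mrestr lebesgue_rV mOmega setT)%E by rewrite /mrestr setTI.
rewrite /finite_norm unlock O0'.
move=> /(@ess_supr_bounded _ _ _ (mrestr lebesgue_rV mOmega) (Num.norm \o f))[M].
by move=> /ae_mrestr; exists M.
Qed.

Local Notation ess_inf_near f delta :=
  (ess_inf (mrestr lebesgue_rV (measurable_thickeningI C delta mOmega))
     (EFin \o f)).

(** The limit exists by monotonicity and is finite because the traces of the
    neighborhoods have positive measure.  It is a cluster value: were it not,
    then near [C] almost no value of [f] would lie within r of [l], whereas
    almost all are above [l - r / 2]; so almost all would be at least [l + r],
    and the essential infimum there would exceed its supremum [l]. *)
Lemma ess_inf_cvg_cluster (f : E -> R) (M : R) :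
  (forall delta, 0 < delta ->
    (0 < lebesgue_rV (thickening C delta `&` Omega))%E) ->
  (\forall x \ae lebesgue_rV, Omega x -> `|f x| <= M) ->
  exists l : R, [/\ ess_inf_near f delta @[delta --> 0^'+] --> l%:E,
    ess_cluster_value Omega C f l &
    forall e, 0 < e -> exists2 r, 0 < r &
      \forall x \ae lebesgue_rV, (thickening C r `&` Omega) x -> l - e <= f x].
Proof.
move=> C_gt0 fM; pose g delta := ess_inf_near f delta.
have gP delta : \forall x \ae lebesgue_rV,
    (thickening C delta `&` Omega) x -> (g delta <= (f x)%:E)%E.
  by have /ae_mrestr := ess_inf_le
    (mrestr lebesgue_rV (measurable_thickeningI C delta mOmega)) (EFin \o f).
have g_ge delta (y : \bar R) : (\forall x \ae lebesgue_rV,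
    (thickening C delta `&` Omega) x -> (y <= (f x)%:E)%E) -> (y <= g delta)%E.
  by move=> h; apply/ess_infP/ae_mrestr.
have g_noninc : {in Interval (BRight 0) +oo%O &, nonincreasing_fun g}.
  move=> d d' _ _ dd'; apply: g_ge; apply: filterS (gP d') => x h [Cx Ox].
  by apply: h; split => //; exact: thickeningS dd' _ Cx.
have := @nonincreasing_at_right_cvge R g 0 +oo%O isT g_noninc.
set L := ereal_sup _ => gL.
have gleL d : 0 < d -> (g d <= L)%E.
  by move=> d0; apply: ereal_sup_ubound; exists d => //=; rewrite in_itv/= d0.
have L_fin : L \is a fin_num.
  rewrite fin_real//; apply/andP; split.
    apply: (@lt_le_trans _ _ (- M)%:E); first exact: ltNyr.
    apply: le_trans (gleL 1 ltr01); apply: g_ge.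
    by apply: filterS fM => x h [_ /h]; rewrite ler_norml lee_fin => /andP[].
  apply: (@le_lt_trans _ _ M%:E); last exact: ltry.
  apply: ge_ereal_sup => _ [d /= + <-]; rewrite in_itv/= andbT => d0.
  rewrite -(@ess_inf_cst _ _ _
    (mrestr lebesgue_rV (measurable_thickeningI C d mOmega)) M%:E).
    apply: le_ess_inf; apply/ae_mrestr; apply: filterS fM => x h [_ /h].
    by rewrite ler_norml lee_fin => /andP[].
  suff : (0 < mrestr lebesgue_rV (measurable_thickeningI C d mOmega) setT)%E
    by [].
  by rewrite /mrestr setTI; exact: C_gt0.
have Ll : L = (fine L)%:E by rewrite fineK.
set l := fine L in Ll; rewrite Ll in gL gleL.
have l_lower e : 0 < e -> exists2 r, 0 < r & \forall x \ae lebesgue_rV,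
    (thickening C r `&` Omega) x -> l - e <= f x.
  move=> e0; have : ((l - e)%:E < L)%E by rewrite Ll lte_fin ltrBlDr ltrDl.
  move=> /ereal_sup_gt[_ [r /= + <-]]; rewrite in_itv/= andbT => r0 ler.
  exists r => //; apply: filterS (gP r) => x /[apply] grx.
  by rewrite -lee_fin; exact: le_trans (ltW ler) grx.
exists l; split => //.
(* Any fraction of r would do: it only has to exclude the values below l - r. *)
move=> r r0 hr; have [r1 r10 hr1] := l_lower _ (divr_gt0 r0 (ltr0n _ 2)).
have d0 : 0 < Num.min r r1 by rewrite lt_min r0.
have : ((l + r)%:E <= g (Num.min r r1))%E.
  apply: g_ge; apply: filterS2 hr hr1 => x hr hr1 [Cx Ox].
  rewrite lee_fin leNgt; apply/negP => flr; apply: hr; split.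
    by split => //; apply: thickeningS Cx; rewrite ge_min lexx.
  rewrite /= ltr_distl flr andbT; apply: lt_le_trans (hr1 _).
    by rewrite ltrD2l ltrN2 ltr_pdivrMr// ltr_pMr// ltr1n.
  by split => //; apply: thickeningS Cx; rewrite ge_min lexx orbT.
by move=> /le_trans/(_ (gleL _ d0)); rewrite lee_fin gerDl leNgt r0.
Qed.

End essential_limits.

(** * Extreme integrals over density measures *)

Theorem theorem3p11 (R : realType) (n : nat) (Omega C : set 'rV[R]_n)
    (mOmega : measurable Omega) (bC : bounded_set C)
    (dC : density_set Omega C) (f : 'rV[R]_n -> R) (fL : Linfty mOmega f) :
  ess_inf (mrestr lebesgue_rV (measurable_thickeningI C delta mOmega))
      (EFin \o f) @[delta --> 0^'+] -->
    ereal_inf [set ba_integral Omega mu f | mu in density_measure Omega C]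
  /\
  ess_sup (mrestr lebesgue_rV (measurable_thickeningI C delta mOmega))
      (EFin \o f) @[delta --> 0^'+] -->
    ereal_sup [set ba_integral Omega mu f | mu in density_measure Omega C].
Proof.
have [_ _ _ _ C_gt0] := dC; have mf := fL.1.
have O_gt0 : (0 < lebesgue_rV Omega)%E.
  apply: lt_le_trans (C_gt0 1 ltr01) _; apply: le_measure; last exact: subIsetr.
    by rewrite inE; exact: measurable_thickeningI.
  by rewrite inE.
have [M fM] := Linfty_ae_bounded O_gt0 fL.
split.
  have [l [cvl /(ess_cluster_value_integral mOmega mf fM)[mu0 dmu0 mu0l] lbl]] :=
    ess_inf_cvg_cluster mOmega C_gt0 fM.
  suff -> : ereal_inf
      [set ba_integral Omega mu f | mu in density_measure Omega C] = l%:E by [].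
  apply/eqP; rewrite eq_le; apply/andP; split.
    by apply: ereal_inf_lbound; exists mu0.
  apply: le_ereal_inf_tmp => _ [mu [bamu mu_ge0 muC muO] <-].
  have [l' [-> hl']] := ba_integral_bounds mOmega bamu mu_ge0 muO mf fM.
  rewrite lee_fin; apply/ler_addgt0Pr => e e0; have [r r0 hr] := lbl e e0.
  have /andP[+ _] : l - e <= l' <= M.
    apply: (hl' (thickening C r `&` Omega)); last first.
    - apply: filterS2 fM hr => x fxM hx CO; rewrite hx//=.
      exact: le_trans (ler_norm _) (fxM CO.2).
    - exact: muC.
    - by split; [exact: measurable_thickeningI|exact: subIsetr].
  by rewrite lerBlDr.
(* The essential supremum of f is minus the essential infimum of - f, and
   cluster values of - f are the opposites of cluster values of f. *)
have fNM : \forall x \ae lebesgue_rV, Omega x -> `|- f x| <= M.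
  by apply: filterS fM => x; rewrite normrN.
have [l [cvl clN lbl]] := ess_inf_cvg_cluster mOmega C_gt0 fNM.
have /(ess_cluster_value_integral mOmega mf fM)[mu0 dmu0 mu0l] :
    ess_cluster_value Omega C f (- l).
  move=> r r0 h; apply: (clN r r0); apply: filterS h => x h [CO /= fl].
  by apply: h; split => //=; rewrite opprK -normrN opprD.
suff -> : ereal_sup
    [set ba_integral Omega mu f | mu in density_measure Omega C] = (- l)%:E.
  under eq_fun do rewrite ess_supEN.
  by rewrite EFinN; exact: cvgeN.
apply/eqP; rewrite eq_le; apply/andP; split; last first.
  by apply: ereal_sup_ubound; exists mu0.
apply: ge_ereal_sup => _ [mu [bamu mu_ge0 muC muO] <-].
have [l' [-> hl']] := ba_integral_bounds mOmega bamu mu_ge0 muO mf fM.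
rewrite lee_fin; apply/ler_addgt0Pr => e e0; have [r r0 hr] := lbl e e0.
have /andP[_ +] : - M <= l' <= - l + e; last by [].
apply: (hl' (thickening C r `&` Omega)); last first.
- apply: filterS2 fM hr => x fxM hx CO; apply/andP; split.
    exact: lerNnormlW (fxM CO.2).
  by have := hx CO; lra.
- exact: muC.
- by split; [exact: measurable_thickeningI|exact: subIsetr].
Qed.
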